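(* Let $M'$, $M$ be Coxeter matrices over finite sets $I'$, $I$ and let $\phi:(W(M'),\star)\to (W(M),\star)$ be a homomorphism of Hecke monoids. Suppose that $\phi$ is also a homomorphism of Coxeter groups $W(M')\to W(M)$. Then $\phi$ is parabolic. Moreover, $\phi$ is injective if and only if it does not map any generator $s'_i$, $i\in I'$, to $1$.
   Context: A Coxeter matrix over a finite set $I$ is a symmetric matrix $M=(m_{ij})_{i,j\in I}$ with $m_{ii}=1$ and $m_{ij}\in\mathbb Z_{\ge 2}\cup\{\infty\}$ for $i\ne j$. The Coxeter group $W(M)$ is generated by $s_i$, $i\in I$, subject to $(s_is_j)^{m_{ij}}=1$ whenever $m_{ij}\neq\infty$; $\ell$ is its length function. The Hecke monoid $(W(M),\star)$ is the monoid generated by $s_i$, $i\in I$, subject to $s_i\star s_i=s_i$ and $s_i\star s_j\star\cdots=s_j\star s_i\star\cdots$ ($m_{ij}$ factors on each side) for $i\ne j$ with $m_{ij}<\infty$. Its underlying set is identified with $W(M)$ so that $s_i\star w=s_iw$ if $\ell(s_iw)>\ell(w)$ and $s_i\star w=w$ otherwise (and similarly on the right); thus a map $W(M')\to W(M)$ can be simultaneously a homomorphism of Hecke monoids and of Coxeter groups. Generators for $M'$ are denoted $s'_i$. Homomorphisms of monoids map identity to identity. For $J\subset I$, $W_J(M)$ is the subgroup generated by $s_j$, $j\in J$. $J$ is of finite type if $W_J(M)$ is finite, and $\mathscr F(M)$ is the set of all subsets of $I$ of finite type. For $J\in\mathscr F(M)$, $w_\circ^J$ is the longest element of $W_J(M)$.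 For $J\subset K\in\mathscr F(M)$ put $w_{J;K}:=w_\circ^Jw_\circ^K$ (product in the Coxeter group). The support $\operatorname{supp} w$ of $w\in W(M)$ is the set of $i\in I$ such that $s_i$ occurs in a reduced expression of $w$. For a homomorphism of Hecke monoids $\phi:(W(M'),\star)\to(W(M),\star)$ set $[\phi](i)=\operatorname{supp}\phi(s'_i)$, $i\in I'$, and $[\phi](K')=\bigcup_{k\in K'}[\phi](k)$ for $K'\subset I'$; it is known that $[\phi](K')\in\mathscr F(M)$ whenever $K'\in\mathscr F(M')$. The homomorphism $\phi$ is called parabolic if for each $K'\in\mathscr F(M')$ and each $J'\subset K'$ there exists $J\subset[\phi](K')$ such that $\phi(w_{J';K'})=w_{J;[\phi](K')}$. *)

(* Defs.v *)
From HB Require Import structures.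
From mathcomp Require Import all_boot.
From mathcomp Require Import boolp classical_sets cardinality.

Set Implicit Arguments.
Unset Strict Implicit.
Unset Printing Implicit Defensive.

Local Open Scope group_scope.

(* The monoid <T | R>: words in T modulo the least congruence containing R.   *)
Section PresentedMonoid.
Variables (T : choiceType) (R : seq T -> seq T -> Prop).

Inductive word_eq : seq T -> seq T -> Prop :=
| word_eq_rel a b u v : R u v -> word_eq (a ++ u ++ b) (a ++ v ++ b)
| word_eq_refl u : word_eq u u
| word_eq_sym u v : word_eq u v -> word_eq v u
| word_eq_trans u v w : word_eq u v -> word_eq v w -> word_eq u w.

Definition word_eqb (u v : seq T) : bool := `[< word_eq u v >].

Lemma word_eqb_refl : reflexive word_eqb.
Proof. by move=> u; apply/asboolP; apply: word_eq_refl. Qed.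

Lemma word_eqb_sym : symmetric word_eqb.
Proof. by move=> u v; apply/asboolP/asboolP; apply: word_eq_sym. Qed.

Lemma word_eqb_trans : transitive word_eqb.
Proof.
by move=> v u w /asboolP uv /asboolP vw; apply/asboolP/(word_eq_trans uv).
Qed.

Canonical word_equiv := EquivRel word_eqb word_eqb_refl word_eqb_sym
  word_eqb_trans.

Definition presented := {eq_quot word_equiv}%qT.

HB.instance Definition _ := Choice.on presented.

Definition word (u : seq T) : presented := (\pi_({eq_quot word_equiv}) u)%qT.

Lemma wordP u v : word u = word v <-> word_eq u v.
Proof.
split=> [/eqmodP/asboolP//|uv].
by apply/eqmodP/asboolP.
Qed.

Lemma word_repr x : word (repr x) = x.
Proof. by rewrite /word reprK. Qed.

Lemma word_surj (x : presented) : exists u, word u = x.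
Proof. by exists (repr x); rewrite word_repr. Qed.

Lemma word_eq_cat2l a u v : word_eq u v -> word_eq (a ++ u) (a ++ v).
Proof.
elim=> {u v} [c d u v uv|u|u v _|u v w _ uv _]; first last.
- exact: word_eq_trans uv.
- exact: word_eq_sym.
- exact: word_eq_refl.
by rewrite !(catA a); apply: word_eq_rel.
Qed.

Lemma word_eq_cat2r a u v : word_eq u v -> word_eq (u ++ a) (v ++ a).
Proof.
elim=> {u v} [c d u v uv|u|u v _|u v w _ uv _]; first last.
- exact: word_eq_trans uv.
- exact: word_eq_sym.
- exact: word_eq_refl.
by rewrite -!catA; apply: word_eq_rel.
Qed.

Definition pmul (x y : presented) : presented :=
  locked (word (repr x ++ repr y)).
Definition pone : presented := word [::].

Lemma pmul_word u v : pmul (word u) (word v) = word (u ++ v).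
Proof.
rewrite /pmul -lock; apply/wordP; apply: (@word_eq_trans _ (u ++ repr (word v))).
  by apply/word_eq_cat2r/wordP; rewrite word_repr.
by apply/word_eq_cat2l/wordP; rewrite word_repr.
Qed.

Lemma pmulA : associative pmul.
Proof.
move=> x y z; rewrite -(word_repr x) -(word_repr y) -(word_repr z).
by rewrite !pmul_word catA.
Qed.

Lemma pmul1l : left_id pone pmul.
Proof. by move=> x; rewrite -(word_repr x) pmul_word. Qed.

Lemma pmul1r : right_id pone pmul.
Proof. by move=> x; rewrite -(word_repr x) pmul_word cats0. Qed.

HB.instance Definition _ := isMonoid.Build presented pmulA pmul1l pmul1r.

Lemma word_nil : word [::] = 1. Proof. by []. Qed.

Lemma word_cat u v : word (u ++ v) = word u * word v.
Proof. by rewrite -pmul_word. Qed.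

Lemma presented_lift (G : monoidType) (f : T -> G) :
  (forall u v, R u v -> \prod_(i <- u) f i = \prod_(i <- v) f i) ->
  exists2 F : presented -> G,
    monoid_morphism F & forall i, F (word [:: i]) = f i.
Proof.
move=> fR; pose F (x : presented) := \prod_(i <- repr x) f i.
have F_eq u v : word_eq u v -> \prod_(i <- u) f i = \prod_(i <- v) f i.
  elim=> {u v} [a b u v /fR uv|//|u v _ ->|u v w _ -> _ ->] //.
  by rewrite !big_cat /= uv.
have FE u : F (word u) = \prod_(i <- u) f i.
  by apply/F_eq/wordP; rewrite word_repr.
exists F; last by move=> i; rewrite FE big_seq1.
split; first by rewrite -word_nil FE big_nil.
move=> x y; rewrite -(word_repr x) -(word_repr y) -word_cat !FE.
by rewrite big_cat.
Qed.

End PresentedMonoid.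

(* An entry None stands for m_ij = oo.                                        *)
Record coxeter_matrix (I : finType) := CoxeterMatrix {
  cox_entry :> I -> I -> option nat;
  cox_sym : forall i j, cox_entry i j = cox_entry j i;
  cox_diag : forall i, cox_entry i i = Some 1%N;
  cox_offdiag : forall i j m, i != j -> cox_entry i j = Some m -> (1 < m)%N
}.

Section Coxeter.
Variables (I : finType) (M : coxeter_matrix I).

(* The word i j i ... with m letters.                                         *)
Fixpoint alt_word (m : nat) (i j : I) : seq I :=
  if m is m'.+1 then i :: alt_word m' j i else [::].

(* Since m_ii = 1, each generator is its own inverse, so the monoid with this *)
(* presentation is also the group with this presentation.                     *)
Inductive coxeter_rel : seq I -> seq I -> Prop :=
| CoxeterRel i j m : M i j = Some m ->
    coxeter_rel (flatten (nseq m [:: i; j])) [::].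

Definition coxeter_group := presented coxeter_rel.

HB.instance Definition _ := Monoid.on coxeter_group.

Definition cox_word (u : seq I) : coxeter_group := word coxeter_rel u.

Definition cox_gen (i : I) : coxeter_group := cox_word [:: i].

Lemma cox_word_cat u v : cox_word (u ++ v) = cox_word u * cox_word v.
Proof. exact: word_cat. Qed.

Lemma cox_gen_sq i : cox_gen i * cox_gen i = 1.
Proof.
rewrite -cox_word_cat; apply/wordP.
have := CoxeterRel (cox_diag M i).
by move/(word_eq_rel [::] [::]).
Qed.

Lemma cox_word_revV u : cox_word (rev u) * cox_word u = 1.
Proof.
elim: u => [|i u IHu]; first by rewrite -cox_word_cat.
rewrite rev_cons -cat1s -cats1 !cox_word_cat.
by rewrite mulgA -[X in X * _]mulgA (cox_gen_sq i) mulg1 IHu.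
Qed.

Definition cox_inv (x : coxeter_group) : coxeter_group :=
  locked (cox_word (rev (repr x))).

HB.instance Definition _ := hasInv.Build coxeter_group cox_inv.

Lemma cox_mulVg : left_inverse 1 cox_inv *%g.
Proof. by move=> x; rewrite /cox_inv -lock -{2}(word_repr x) cox_word_revV. Qed.

Lemma cox_mulgV : right_inverse 1 cox_inv *%g.
Proof.
move=> x; rewrite /cox_inv -lock -{1}(word_repr x) -{1}[repr x]revK.
exact: (cox_word_revV (rev (repr x))).
Qed.

HB.instance Definition _ :=
  Monoid_isGroup.Build coxeter_group cox_mulVg cox_mulgV.

Lemma cox_gen_rel i j m : M i j = Some m -> (cox_gen i * cox_gen j) ^+ m = 1.
Proof.
move=> Mij.
have -> : (cox_gen i * cox_gen j) ^+ m = cox_word (flatten (nseq m [:: i; j])).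
  elim: m {Mij} => [|m IHm] //.
  by rewrite expgS IHm -!cox_word_cat.
by have /(word_eq_rel [::] [::]) := CoxeterRel Mij; rewrite !cats0 => /wordP.
Qed.

(* Universal property of the Coxeter group among groups.                      *)
Lemma coxeter_group_lift (G : groupType) (f : I -> G) :
  (forall i j m, M i j = Some m -> (f i * f j) ^+ m = 1) ->
  exists2 F : coxeter_group -> G,
    monoid_morphism F & forall i, F (cox_gen i) = f i.
Proof.
move=> fM; apply: presented_lift => _ _ [i j m /fM fij]; rewrite big_nil.
rewrite -[RHS]fij {fij}; elim: m => [|m IHm] /=; first by rewrite big_nil.
by rewrite !big_cons IHm expgS mulgA.
Qed.

Lemma cox_word_ex (w : coxeter_group) :
  exists n, `[< exists2 u, cox_word u = w & size u = n >].
Proof.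
by have [u uw] := word_surj w; exists (size u); apply/asboolP; exists u.
Qed.

Definition len (w : coxeter_group) : nat := ex_minn (cox_word_ex w).

Definition reduced_expr (w : coxeter_group) (u : seq I) : Prop :=
  cox_word u = w /\ size u = len w.

Lemma reduced_expr_ex w : exists u, reduced_expr w u.
Proof.
by rewrite /reduced_expr /len; case: ex_minnP => n /asboolP[u <- <-] _; exists u.
Qed.

Definition supp (w : coxeter_group) : {set I} :=
  [set i | `[< exists2 u, reduced_expr w u & i \in u >]].

Definition cox_subgroup (J : {set I}) : set coxeter_group :=
  smallest [set S : set coxeter_group | group_closed (mem S)]%classic
           [set cox_gen j | j in [set` J]]%classic.

Definition finite_type (J : {set I}) : Prop := finite_set (cox_subgroup J).

Definition is_longest (J : {set I}) (w : coxeter_group) : Prop :=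
  cox_subgroup J w /\ forall v, cox_subgroup J v -> (len v <= len w)%N.

(* Existence and uniqueness of the longest element hold when J is of finite   *)
(* type; the default value 1 is irrelevant in that case.                      *)
Definition longest (J : {set I}) : coxeter_group := xget 1 (is_longest J).

Definition w_rel (J K : {set I}) : coxeter_group := longest J * longest K.

Inductive hecke_rel : seq I -> seq I -> Prop :=
| HeckeIdem i : hecke_rel [:: i; i] [:: i]
| HeckeBraid i j m : i != j -> M i j = Some m ->
    hecke_rel (alt_word m i j) (alt_word m j i).

Definition hecke_monoid := presented hecke_rel.

HB.instance Definition _ := Monoid.on hecke_monoid.

Definition hecke_word (u : seq I) : hecke_monoid := word hecke_rel u.

Lemma hecke_word_cat u v : hecke_word (u ++ v) = hecke_word u * hecke_word v.
Proof. exact: word_cat. Qed.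

(* The identification of the underlying sets of W(M) and of the Hecke monoid: *)
(* the rule s_i * w = s_i w for l(s_i w) > l(w) forces s_i1 ... s_il to       *)
(* correspond to the Hecke product of s_i1, ..., s_il for every reduced word. *)
(* By Matsumoto's theorem the reduced word chosen here does not matter.       *)
Definition to_hecke (w : coxeter_group) : hecke_monoid :=
  hecke_word (sval (cid (reduced_expr_ex w))).

End Coxeter.

Section Homomorphisms.
Variables (I' I : finType) (M' : coxeter_matrix I') (M : coxeter_matrix I).
Implicit Type phi : coxeter_group M' -> coxeter_group M.

(* phi, read through the identifications to_hecke, is a morphism of monoids.  *)
Definition hecke_morphism phi : Prop :=
  exists2 F : hecke_monoid M' -> hecke_monoid M,
    monoid_morphism F & forall w, to_hecke (phi w) = F (to_hecke w).

(* [phi](K'); it is of finite type for K' of finite type, so that [longest]    *)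
(* is meaningful wherever [parabolic] uses it.                                *)
Definition bracket phi (K' : {set I'}) : {set I} :=
  \bigcup_(k in K') supp (phi (cox_gen M' k)).

Definition parabolic phi : Prop :=
  forall K' J' : {set I'}, finite_type M' K' -> J' \subset K' ->
  exists2 J : {set I}, J \subset bracket phi K' &
    phi (w_rel M' J' K') = w_rel M J (bracket phi K').

End Homomorphisms.

(* Main.v *)
Require Import Defs.
From mathcomp Require Import boolp classical_sets cardinality.
From mathcomp Require Import all_boot all_order all_algebra all_field ring.

(* A Hecke idempotent e is the longest element of W_(supp e): the subwords of a
   Hecke word u represent a set of elements of W that depends only on the class
   of u, and since the letters of e are absorbed by e, every element of
   W_(supp e) is represented by a subword of a reduced word of e.  Conversely,
   the longest element of W_K is a Hecke idempotent with support K.  As a Hecke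
   morphism, phi preserves idempotents and satisfies
   supp (phi w) = [phi](supp w); so phi maps the longest element of W_K' to
   that of W_[phi](K').  Being also a group morphism, phi is then parabolic,
   with J = [phi](J'), and the support formula shows that its kernel is trivial
   when no supp (phi s'_i) is empty.

   Reading phi on Hecke words requires Matsumoto's theorem.  The exchange
   condition comes from the parity with which a reflection occurs in a word; the
   order of s_i s_j is m_ij by the geometric representation, taken over algC. *)

Set Implicit Arguments.
Unset Strict Implicit.
Unset Printing Implicit Defensive.

Local Open Scope group_scope.

(** * The exchange condition, via parities of reflections *)

Section Exchange.
Variables (I : finType) (M : coxeter_matrix I).
Implicit Types (i j k : I) (u v a b c : seq I) (w t : coxeter_group M).

Local Notation s := (cox_gen M).
Local Notation W := (cox_word M).

Lemma cox_word_cons i u : W (i :: u) = s i * W u.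
Proof. by rewrite -cat1s cox_word_cat. Qed.

Lemma cox_genV i : (s i)^-1 = s i.
Proof. exact: mulg1_eq (cox_gen_sq M i). Qed.

Lemma cox_genK i w : s i * (s i * w) = w.
Proof. by rewrite mulgA cox_gen_sq mul1g. Qed.

(* The parity of the number of indices n at which the reflection              *)
(* u_0 ... u_(n-1) u_n u_(n-1) ... u_0 attached to the word u is t.           *)
Fixpoint refl_parity u t : bool :=
  if u is i :: v then (t == s i) (+) refl_parity v (t ^ s i) else false.

Lemma refl_parity_cat u v t :
  refl_parity (u ++ v) t = refl_parity u t (+) refl_parity v (t ^ W u).
Proof.
elim: u t => [|i u IHu] t /=; first by rewrite conjg1.
by rewrite IHu cox_word_cons conjgM addbA.
Qed.

Lemma refl_parity_alt i j n t :
  refl_parity (flatten (nseq n [:: i; j])) t =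
  \big[addb/false]_(0 <= k < n.*2) (t == (s i * s j) ^+ k * s i).
Proof.
elim: n t => [|n IHn] t; first by rewrite big_nil.
rewrite doubleS big_nat_recl // big_nat_recl // /= IHn mul1g.
congr (_ (+) (_ (+) _)).
  apply/eqP/eqP=> [<-|->].
    by rewrite conjgE cox_genV !mulgA cox_gen_sq mul1g -mulgA cox_gen_sq mulg1.
  by rewrite conjgE cox_genV !mulgA cox_gen_sq mul1g -mulgA cox_gen_sq mulg1.
apply: eq_bigr => k _; rewrite -conjgM; set c := s i * s j.
(* [s_i] inverts [c], so conjugating [c^k s_i] by [c^-1] raises its exponent by two. *)
have cV : s i * c^-1 = c * s i.
  by rewrite /c invgM !cox_genV mulgA.
clearbody c; have -> : c ^+ k.+2 * s i = (c ^+ k * s i) ^ c^-1.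
  by rewrite expgS expgSr conjgE invgK -!mulgA cV.
by rewrite -(inj_eq (@conjg_inj _ c^-1)) conjgK.
Qed.

(** The [2m] reflections of a relator [(s_i s_j)^m] run twice through the same list of [m], so they
    cancel in pairs; the conjugation applied to the tail depends only on the group element. *)
Lemma refl_parity_word_eq u v :
  word_eq (coxeter_rel M) u v -> refl_parity u =1 refl_parity v.
Proof.
elim=> {u v} [a b _ _ [i j m Mij]|//|u v _ uv|u v w _ uv _ vw] t; first last.
- by rewrite uv vw.
- by rewrite uv.
rewrite !refl_parity_cat; congr (_ (+) (_ (+) _)); last first.
  congr (refl_parity b (_ ^ _)).
  by have /(word_eq_rel [::] [::]) := CoxeterRel Mij; rewrite !cats0 => /wordP.
rewrite refl_parity_alt -addnn (@big_cat_nat _ _ _ m) ?leq_addr //=.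
rewrite -[X in _ (+) \big[_/_]_(X <= _ < _) _]add0n big_addn addnK.
under [X in _ (+) X]eq_bigr do rewrite expgnDr (cox_gen_rel Mij) mulg1.
exact: addbb.
Qed.

(** An odd count means that [t] is attached to some letter; multiplying by that reflection deletes
    the letter. *)
Lemma refl_parity_deletion u t : refl_parity u t ->
  exists a i b, u = a ++ i :: b /\ t * W u = W (a ++ b).
Proof.
elim: u t => //= i u IHu t; have [-> _|_ /=] := eqVneq t (s i).
  by exists [::], i, u; rewrite cox_word_cons cox_genK.
move/IHu => [a [k [b [-> E]]]]; exists (i :: a), k, b; split=> //.
rewrite !cox_word_cons -E conjgE cox_genV -!mulgA.
by rewrite cox_genK.
Qed.

Lemma len_cox_word u : len (W u) <= size u.
Proof.
by rewrite /len; case: ex_minnP => n _; apply; apply/asboolP; exists u.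
Qed.

Lemma reduced_exprE u : size u <= len (W u) -> reduced_expr (W u) u.
Proof. by move=> h; split=> //; apply/eqP; rewrite eqn_leq h len_cox_word. Qed.

Lemma len_gen_le i w : len (s i * w) <= (len w).+1.
Proof.
have [u [<- <-]] := reduced_expr_ex w.
by rewrite -cox_word_cons; apply: len_cox_word.
Qed.

(** If [s_i] has even parity in [u], it has odd parity in [i :: u], hence in a reduced word of
    [s_i W(u)]; deleting a letter there would give too short a word for [W(u)]. *)
Lemma exchange i u : len (s i * W u) <= len (W u) ->
  exists a k b, u = a ++ k :: b /\ s i * W u = W (a ++ b).
Proof.
move=> le_iu; have [/refl_parity_deletion //|Nui] := boolP (refl_parity u (s i)).
have [v [vE sz_v]] := reduced_expr_ex (s i * W u).
have /refl_parity_deletion[a [k [b [vab E]]]]: refl_parity v (s i).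
  have /refl_parity_word_eq-> : word_eq (coxeter_rel M) v (i :: u).
    by apply/wordP; rewrite -[LHS]/(W v) vE -cox_word_cons.
  by rewrite /= eqxx conjgE cox_gen_sq mulg1 cox_genV (negPf Nui).
rewrite vE cox_genK in E.
have := len_cox_word (a ++ b); rewrite -E leqNgt => /negP[].
by rewrite (leq_trans _ le_iu) // -sz_v vab !size_cat /= addnS.
Qed.

Lemma len_gen_lt i w : len (s i * w) <= len w -> len (s i * w) < len w.
Proof.
have [u [<- sz_u]] := reduced_expr_ex w.
move=> /exchange[a [k [b [E ->]]]].
by rewrite -sz_u E (leq_ltn_trans (len_cox_word _)) // !size_cat /= addnS.
Qed.

Lemma len_gen_down i w : len (s i * w) <= len w -> len w = (len (s i * w)).+1.
Proof.
move/len_gen_lt => lt; apply/eqP; rewrite eqn_leq lt andbT.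
by rewrite -{1}[w](cox_genK i) len_gen_le.
Qed.

Lemma len1 : len (1 : coxeter_group M) = 0.
Proof. by apply/eqP; rewrite -leqn0 (len_cox_word [::]). Qed.

Lemma cox_gen_neq1 i : s i != 1.
Proof.
apply/eqP => si1; have := @len_gen_lt i 1.
by rewrite si1 mulg1 leqnn ltnn => /(_ isT).
Qed.

Lemma reduced_gen i : reduced_expr (s i) [:: i].
Proof.
apply: reduced_exprE => /=; rewrite lt0n; apply/eqP => l0.
have [v [E]] := reduced_expr_ex (s i); rewrite l0 => /size0nil v0.
by have := cox_gen_neq1 i; rewrite -E v0 eqxx.
Qed.

Lemma reduced_cons i u : reduced_expr (W u) u -> len (W u) < len (s i * W u) ->
  reduced_expr (W (i :: u)) (i :: u).
Proof.
by move=> [_ sz_u] lt; apply: reduced_exprE; rewrite cox_word_cons /= sz_u.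
Qed.

Lemma reduced_catr a u : reduced_expr (W (a ++ u)) (a ++ u) ->
  reduced_expr (W u) u.
Proof.
elim: a => //= i a IHa [_ sz]; apply: IHa; apply: reduced_exprE.
by rewrite -ltnS [X in X <= _]sz cox_word_cons len_gen_le.
Qed.

Lemma reduced_consP i u :
  reduced_expr (W (i :: u)) (i :: u) -> len (W u) < len (W (i :: u)).
Proof. by move=> r; rewrite -(r.2) -((@reduced_catr [:: i] u r).2). Qed.

(** Letters are added on the left; one that fails to lengthen is traded for a deletion by
    [exchange]. *)
Lemma reduced_subseq_ex u : exists2 v, subseq v u & reduced_expr (W u) v.
Proof.
elim: u => [|i u [v vu [vE sz_v]]].
  by exists [::] => //; split; rewrite ?len1.
have [le|lt] := leqP (len (s i * W v)) (len (W v)).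
  have [a [k [b [vab E]]]] := exchange le; exists (a ++ b).
    apply: subseq_trans (subseq_cons u i); apply: subseq_trans vu.
    by rewrite vab cat_subseq ?subseq_refl ?subseq_cons.
  rewrite cox_word_cons -vE E; apply: reduced_exprE.
  by rewrite -E -ltnS -(len_gen_down le) vE -sz_v vab !size_cat /= addnS.
exists (i :: v); first by rewrite /= eqxx.
rewrite cox_word_cons -vE -cox_word_cons; apply: reduced_cons => //.
by split; rewrite ?vE.
Qed.

End Exchange.

(** * The order of [s_i s_j], via a linear action *)

Section NumbersGame.
Import GRing.Theory Num.Theory.
Local Open Scope ring_scope.
Variables (I : finType) (M : coxeter_matrix I).
Implicit Types (i j k : I) (u v : seq I) (f : I -> algC) (z : algC).

(** The order is taken as [n.-1.+1] to make this total; it is [n] when [n] is positive. *)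
Definition prim_root (n : nat) : algC :=
  sval (C_prim_root_exists (ltn0Sn n.-1)).

Lemma prim_rootP n : (0 < n)%N -> n.-primitive_root (prim_root n).
Proof.
move=> n0; rewrite /prim_root; case: C_prim_root_exists => z /=.
by rewrite prednK.
Qed.

(* A Galois conjugate of the usual Cartan entry - 2 cos (pi / m_ij).          *)
Definition cartan i j : algC :=
  if M i j is Some m then - (prim_root m.*2 + (prim_root m.*2)^-1) else - 2.

Lemma cartan_sym i j : cartan i j = cartan j i.
Proof. by rewrite /cartan cox_sym. Qed.

Lemma cartan_diag i : cartan i i = 2.
Proof.
rewrite /cartan cox_diag.
have z2 := @prim_rootP 2 isT; set z := prim_root _ in z2 *.
have -> : z = -1.
  have /eqP := prim_expr_order z2; rewrite sqrf_eq1 => /orP[/eqP z1|/eqP//].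
  by have := prim_order_dvd z2 1; rewrite z1 expr1n eqxx.
by rewrite invrN invr1 opprD opprK.
Qed.

(* The action on functionals contragredient to the geometric representation. *)
Definition fire i f : I -> algC := fun k => f k - cartan i k * f i.

Fixpoint fire_word u f : I -> algC :=
  if u is i :: v then fire_word v (fire i f) else f.

Lemma fire_word_cat u v f : fire_word (u ++ v) f = fire_word v (fire_word u f).
Proof. by elim: u f => /=. Qed.

Section Pair.
Variables (i j : I) (z : algC).
Hypotheses (z_neq0 : z != 0) (cartan_ij : cartan i j = - (z + z^-1)).

Let fire2_i f : fire j (fire i f) i = - f i + (z + z^-1) * fire i f j.
Proof. by rewrite /fire cartan_diag (cartan_sym j i) cartan_ij; ring. Qed.

Let fire2_j f : fire j (fire i f) j = - f j - (z + z^-1) * f i.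
Proof. by rewrite /fire cartan_diag cartan_ij; ring. Qed.

(** [a] and [b] are the coordinates of [(f i, f j)] along the eigenvectors [(1, - z^-1)] and
    [(1, - z)] of one round, with eigenvalues [z^2] and [z^-2]. *)
Lemma fire2_coords f a b : f i = a + b -> f j = - (a * z^-1 + b * z) ->
  fire j (fire i f) i = a * z ^+ 2 + b * z^-1 ^+ 2 /\
  fire j (fire i f) j = - (a * z ^+ 2 * z^-1 + b * z^-1 ^+ 2 * z).
Proof.
move=> fi fj; rewrite fire2_i fire2_j /fire cartan_ij fi fj.
by split; field.
Qed.

Lemma fire_alt_coord n f a b : f i = a + b -> f j = - (a * z^-1 + b * z) ->
  fire_word (flatten (nseq n [:: i; j])) f i =
    a * z ^+ n.*2 + b * z^-1 ^+ n.*2.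
Proof.
elim: n f a b => [|n IHn] f a b fi fj; first by rewrite !mulr1.
have [fi' fj'] := fire2_coords fi fj.
by rewrite /= (IHn _ _ _ fi' fj') doubleS -(add2n n.*2) !exprD !mulrA.
Qed.

(** Round [l] fires [a z^(2l) + b z^(-2l)] at [i], then [a z^(2l+1) + b z^(-2l-1)] at [j]. *)
Lemma fire_altE n f a b k : f i = a + b -> f j = - (a * z^-1 + b * z) ->
  fire_word (flatten (nseq n [:: i; j])) f k =
    f k - cartan i k * (a * (\sum_(l < n) (z ^+ 2) ^+ l)
                        + b * (\sum_(l < n) (z^-1 ^+ 2) ^+ l))
        - cartan j k * (a * z * (\sum_(l < n) (z ^+ 2) ^+ l)
                        + b * z^-1 * (\sum_(l < n) (z^-1 ^+ 2) ^+ l)).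
Proof.
elim: n f a b => [|n IHn] f a b fi fj.
  by rewrite !big_ord0 !(mulr0, addr0, subr0).
have [fi' fj'] := fire2_coords fi fj.
have sumS y : \sum_(l < n.+1) y ^+ l = 1 + y * \sum_(l < n) y ^+ l :> algC.
  rewrite big_ord_recl mulr_sumr; congr (_ + _).
  by apply: eq_bigr => l _; rewrite lift0 exprS.
rewrite /= (IHn _ _ _ fi' fj') !sumS.
set S := \sum_(l < n) _; set T := \sum_(l < n) _.
rewrite /fire cartan_ij fi fj; field.
exact: z_neq0.
Qed.

End Pair.

Lemma sum_root_unity z n : z != 1 -> z ^+ n = 1 -> \sum_(l < n) z ^+ l = 0.
Proof.
move=> z1 zn; apply/eqP; have /eqP := subrX1 z n.
by rewrite zn subrr eq_sym mulf_eq0 subr_eq0 (negPf z1).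
Qed.

Lemma prim_root_sq_neq1 m : (1 < m)%N -> prim_root m.*2 ^+ 2 != 1.
Proof.
move=> m1; have m2 : (0 < m.*2)%N by rewrite double_gt0 ltnW.
rewrite -(prim_order_dvd (prim_rootP m2) 2) gtnNdvd //.
by rewrite -(doubleS 0) ltn_double.
Qed.

Lemma recurrence_solution (F : fieldType) (z x y : F) : z != 0 -> z ^+ 2 != 1 ->
  exists a b, x = a + b /\ y = - (a * z^-1 + b * z).
Proof.
move=> z0 z2; have d0 : z ^+ 2 - 1 != 0 by rewrite subr_eq0.
pose b := - (y * z + x) / (z ^+ 2 - 1).
exists (x - b), b; split; first by rewrite subrK.
by rewrite /b; field; rewrite z0 d0.
Qed.

(** For distinct [i], [j], the total amounts fired are geometric sums over [m] terms whose ratios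
    [z^2], [z^-2] are [m]-th roots of unity other than 1, so they vanish. *)
Lemma fire_relator i j m f : M i j = Some m ->
  fire_word (flatten (nseq m [:: i; j])) f = f.
Proof.
move=> Mij; apply/funext => k; have [eij|neij] := eqVneq i j.
  move: Mij; rewrite -eij cox_diag => -[<-] /=.
  by rewrite /fire cartan_diag; ring.
have m1 := cox_offdiag neij Mij.
have m2 : (0 < m.*2)%N by rewrite double_gt0 ltnW.
have zP := prim_rootP m2; have zsq := prim_root_sq_neq1 m1.
have aij : cartan i j = - (prim_root m.*2 + (prim_root m.*2)^-1).
  by rewrite /cartan Mij.
set z := prim_root _ in aij zP zsq.
have z0 : z != 0.
  by rewrite (prim_root_eq0 zP) -lt0n.
have zz : z ^+ 2 ^+ m = 1 by rewrite -exprM mul2n prim_expr_order.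
have zV : z^-1 ^+ 2 ^+ m = 1 by rewrite exprVn exprVn zz invr1.
have zVsq : z^-1 ^+ 2 != 1 by rewrite exprVn invr_eq1.
have [a [b [fi fj]]] := recurrence_solution (f i) (f j) z0 zsq.
rewrite (fire_altE z0 aij m k fi fj) !sum_root_unity //.
by rewrite !mulr0 !addr0 !mulr0 !subr0.
Qed.

Lemma fire_word_eq u v : word_eq (coxeter_rel M) u v -> fire_word u = fire_word v.
Proof.
elim=> {u v} [a b _ _ [i j m Mij]|//|u v _ uv|u v w _ uv _ vw]; first last.
- by rewrite uv vw.
- by rewrite uv.
by apply/funext => f; rewrite !fire_word_cat fire_relator.
Qed.

Lemma cox_gen_order i j n : i != j -> (0 < n)%N ->
  ((cox_gen M i * cox_gen M j) ^+ n = 1)%g ->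
  exists2 m, M i j = Some m & (m %| n)%N.
Proof.
move=> neij n0 ijn.
have fix_f f : fire_word (flatten (nseq n [:: i; j])) f = f.
  have /fire_word_eq-> // :
    word_eq (coxeter_rel M) (flatten (nseq n [:: i; j])) [::].
  apply/wordP; rewrite -[RHS]ijn; elim: n {n0 ijn} => // n IHn.
  by rewrite expgS -IHn -[LHS]/(cox_word M _) 2!cox_word_cons mulgA.
case Mij: (M i j) => [m|].
  exists m => //; have m1 := cox_offdiag neij Mij.
  have m2 : (0 < m.*2)%N by rewrite double_gt0 ltnW.
  have zP := prim_rootP m2; set z := prim_root _ in zP.
  have aij : cartan i j = - (z + z^-1) by rewrite /cartan Mij.
  have z0 : z != 0 by rewrite (prim_root_eq0 zP) -lt0n.
  (* The eigenvector with [a = 1], [b = 0]: its value at [i] after [n] rounds is [z^(2n)], which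
     must be 1. *)
  pose f k := if k == i then 1 else if k == j then - z^-1 else 0.
  have := fire_alt_coord (f := f) (a := 1) (b := 0) z0 aij n.
  rewrite fix_f /f eqxx eq_sym (negPf neij) eqxx !mul0r !addr0 !mul1r.
  move=> /(_ erefl erefl)/esym/eqP.
  by rewrite -(prim_order_dvd zP n.*2) -!mul2n dvdn_pmul2l.
(* When [m_ij] is infinite, [f i + f j] is invariant and each round adds it twice at [i]. *)
have coord l f : fire_word (flatten (nseq l [:: i; j])) f i =
    f i + (f i + f j) *+ l.*2.
  elim: l f => [|l IHl] f /=; first by rewrite addr0.
  have aij : cartan i j = - 2 by rewrite /cartan Mij.
  have fi' : fire j (fire i f) i = f i + (f i + f j) *+ 2.
    by rewrite /fire cartan_diag (cartan_sym j i) aij; ring.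
  have fj' : fire j (fire i f) i + fire j (fire i f) j = f i + f j.
    by rewrite /fire !cartan_diag (cartan_sym j i) aij; ring.
  by rewrite IHl fj' fi' -addrA -mulrnDr.
pose f k : algC := (k == j)%:R.
have := coord n f; rewrite fix_f /f eqxx (negPf neij) !add0r => /esym/eqP.
by rewrite pnatr_eq0 double_eq0 -leqn0 leqNgt n0.
Qed.

End NumbersGame.

(** * Matsumoto's theorem, subwords and the Hecke action on [W] *)

Section Matsumoto.
Variables (I : finType) (M : coxeter_matrix I).
Implicit Types (i j k : I) (u v a b c : seq I) (w t : coxeter_group M).

Local Notation s := (cox_gen M).
Local Notation W := (cox_word M).
Local Notation H := (hecke_word M).

Lemma hecke_word_cons i u : H (i :: u) = H [:: i] * H u.
Proof. exact: hecke_word_cat [:: i] u. Qed.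

Lemma size_alt_word n i j : size (alt_word n i j) = n.
Proof. by elim: n i j => //= n IHn i j; rewrite IHn. Qed.

Lemma take_alt_word n m i j : n <= m ->
  take n (alt_word m i j) = alt_word n i j.
Proof.
elim: n m i j => [|n IHn] [|m] i j //=.
by move=> nm; rewrite IHn.
Qed.

Lemma prefix_alt_word n m i j : n <= m ->
  subseq (alt_word n i j) (alt_word m i j).
Proof. by move=> nm; rewrite -(take_alt_word i j nm) take_subseq. Qed.

Lemma mem_alt_word n i j k :
  (k \in alt_word n i j) = (0 < n) && (k == i) || (1 < n) && (k == j).
Proof.
elim: n i j => [|n IHn] i j //=; rewrite inE IHn.
case: n {IHn} => [|[|n]] /=; rewrite ?orbF //.
by case: eqP => //=; rewrite ?orbF ?orbT.
Qed.

Lemma cox_alt_swap n i j :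
  W (alt_word n i j) = (s i * s j) ^+ n * W (alt_word n j i).
Proof.
have flip l : (s i * s j) ^+ l.+1 * (s j * (s i * s j) ^+ l) = s i.
  elim: l => [|l IHl]; first by rewrite expg1 mulg1 -mulgA cox_gen_sq mulg1.
  rewrite expgS [X in _ * (_ * X)]expgSr [s j * _]mulgA mulgA.
  rewrite -[X in X * _]mulgA IHl.
  by rewrite -!mulgA cox_genK cox_gen_sq mulg1.
elim: n i j flip => [|n IHn] i j flip; first by rewrite mul1g.
rewrite /= !cox_word_cons (IHn i j) // -[in LHS](flip n).
by rewrite !mulgA.
Qed.

Lemma cox_alt_braid i j m : M i j = Some m ->
  W (alt_word m i j) = W (alt_word m j i).
Proof. by move=> Mij; rewrite cox_alt_swap (cox_gen_rel Mij) mul1g. Qed.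

(* Deleting a letter of the alternating prefix would make s_i the palindrome  *)
(* in s_i, s_j of length 2p+1 starting with s_j, so (s_i s_j)^(p+1) = 1.      *)
Lemma alt_descent n i j w : i != j ->
    len (s i * w) <= len w -> len (s j * w) <= len w ->
    (forall m, M i j = Some m -> n <= m) ->
  exists x, reduced_expr w (alt_word n i j ++ x).
Proof.
elim: n i j => [|n IHn] i j neij di dj leM; first exact: reduced_expr_ex.
have neji : j != i by rewrite eq_sym.
have leM' m : M j i = Some m -> n <= m by rewrite cox_sym => /leM/ltnW.
have [x [xw sz_x]] := IHn j i neji dj di leM'.
move: di; rewrite -xw => /exchange[a [k [b [E iw]]]].
(* If the deleted letter lies in [x], the alternating prefix survives and [i] can be put in front of
   it. *)
have [lea|lta] := leqP n (size a).
  have aE : a = alt_word n j i ++ drop n a.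
    rewrite -{1}(cat_take_drop n a); congr (_ ++ _).
    rewrite -(takel_cat (k :: b) lea) -E take_cat size_alt_word ltnn subnn.
    by rewrite take0 cats0.
  exists (drop n a ++ b); rewrite /= catA -aE.
  have wE : W (alt_word n j i ++ x) = W (i :: a ++ b).
    by rewrite cox_word_cons -iw cox_genK.
  rewrite wE; apply: reduced_exprE.
  by rewrite -wE xw -sz_x E /= !size_cat /= addnS.
have ak : rcons a k = alt_word (size a).+1 j i.
  rewrite -(take_alt_word j i lta) -cats1.
  have -> : take (size a).+1 (alt_word n j i) = take (size a).+1 (a ++ k :: b).
    by rewrite -E takel_cat // size_alt_word.
  by rewrite take_cat ltnNge leqnSn /= subSnn /= take0.
have aE : a = alt_word (size a) j i.
  by rewrite -(take_alt_word j i (leqnSn _)) -ak -cats1 take_size_cat.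
have: W (i :: rcons a k) = W a.
  move: iw; rewrite E cox_word_cons -!cats1 !cox_word_cat cox_word_cons.
  by rewrite !mulgA => /mulIg.
rewrite ak [in RHS]aE /= 2!cox_word_cons cox_alt_swap 2!mulgA -expgS -[RHS]mul1g.
move=> /mulIg /(cox_gen_order neij)[] // m /leM ltm /dvdn_leq lem.
by have := lem isT; rewrite leqNgt (leq_ltn_trans lta ltm).
Qed.

Lemma hecke_alt_braid i j m : i != j -> M i j = Some m ->
  H (alt_word m i j) = H (alt_word m j i).
Proof.
move=> neij Mij; apply/wordP.
by have /(word_eq_rel [::] [::]) := HeckeBraid neij Mij; rewrite !cats0.
Qed.

(** Induction on length; a common first letter cancels. Otherwise both first letters are descents,
    and [alt_descent] gives a reduced word starting with [m] alternating letters. It is compared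
    with [u] and, after a braid move, with [v], each time through a common first letter. *)
Lemma matsumoto u v : reduced_expr (W u) u -> reduced_expr (W v) v ->
  W u = W v -> H u = H v.
Proof.
have [n] := ubnP (size u).
elim: n u v => // n IHn [|i u] [|j v] //= lt_n ru rv uv.
- by have := rv.2; rewrite -uv len1.
- by have := ru.2; rewrite uv len1.
have Hcons k x y : size x < n -> reduced_expr (W (k :: x)) (k :: x) ->
    reduced_expr (W (k :: y)) (k :: y) -> W (k :: x) = W (k :: y) ->
    H (k :: x) = H (k :: y).
  move=> lt_x rx ry; rewrite !cox_word_cons => /mulgI xy.
  rewrite (hecke_word_cons k x) (hecke_word_cons k y); congr (_ * _).
  by apply: IHn => //; apply: (@reduced_catr _ _ [:: k]).
have [eij|neij] := eqVneq i j; first by rewrite -eij in rv uv *; apply: Hcons.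
have di : len (s i * W (i :: u)) <= len (W (i :: u)).
  by rewrite {1}cox_word_cons cox_genK ltnW // reduced_consP.
have dj : len (s j * W (i :: u)) <= len (W (i :: u)).
  by rewrite uv {1}cox_word_cons cox_genK ltnW // reduced_consP.
case Mij: (M i j) => [m|]; last first.
  (* An alternating prefix one letter longer than [i :: u] cannot fit in a reduced word. *)
  have [m|x] := alt_descent (n := (size u).+2) neij di dj; first by rewrite Mij.
  case=> _; rewrite -ru.2 size_cat size_alt_word => /eqP.
  by rewrite gtn_eqF // ltnS leq_addr.
have [m'|x [xE sz_x]] := alt_descent (n := m) neij di dj.
  by rewrite Mij => -[->].
have := cox_offdiag neij Mij; have yE := cox_alt_braid Mij.
have hE := hecke_alt_braid neij Mij.
case: m => // m in sz_x Mij xE yE hE * => _.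
have rx : reduced_expr (W (alt_word m.+1 i j ++ x)) (alt_word m.+1 i j ++ x).
  by rewrite xE.
have yxE : W (alt_word m.+1 i j ++ x) = W (alt_word m.+1 j i ++ x).
  by rewrite !cox_word_cat yE.
have ry : reduced_expr (W (alt_word m.+1 j i ++ x)) (alt_word m.+1 j i ++ x).
  by rewrite -yxE; split; rewrite // xE -sz_x !size_cat !size_alt_word.
transitivity (H (alt_word m.+1 i j ++ x)).
  by apply: Hcons => //; rewrite -xE.
rewrite hecke_word_cat hE -hecke_word_cat; apply/esym/Hcons => //.
  by rewrite -ltnS; have := rv.2; rewrite -uv -ru.2 /= => ->.
by rewrite -[LHS]uv -xE yxE.
Qed.

Lemma to_heckeE w u : reduced_expr w u -> to_hecke w = H u.
Proof.
rewrite /to_hecke; case: cid => v [/= vE sz_v] [uE sz_u].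
by apply: matsumoto; rewrite ?vE ?uE.
Qed.

Lemma to_hecke_gen i : to_hecke (s i) = H [:: i].
Proof. exact/to_heckeE/reduced_gen. Qed.

(* For P = eq 1, this is the lower Bruhat interval of the Demazure product of  *)
(* the letters of u.                                                          *)
Fixpoint subwords u (P : coxeter_group M -> Prop) w : Prop :=
  if u is i :: v then subwords v P w \/ subwords v P (s i * w) else P w.

(** With an arbitrary [P], concatenation becomes composition, so a relation used inside a word need
    only be checked on its two sides. *)
Lemma subwords_cat u v P : subwords (u ++ v) P = subwords u (subwords v P).
Proof. by elim: u => //= i u ->. Qed.

Lemma subwordsP u P w :
  subwords u P w <-> exists2 v, subseq v u & P ((W v)^-1 * w).
Proof.
split.
  elim: u w => [|i u IHu] w /=; first by exists [::]; rewrite // invg1 mul1g.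
  case=> /IHu[v vu Pv].
    by exists v => //; exact: subseq_trans vu (subseq_cons _ _).
  exists (i :: v); first by rewrite /= eqxx.
  by rewrite cox_word_cons invgM cox_genV -mulgA.
elim: u w => [|i u IHu] w [v].
  by rewrite subseq0 => /eqP->; rewrite invg1 mul1g.
case: v => [_|k v /=]; first by left; apply: IHu; exists [::]; rewrite ?sub0seq.
case: eqP => [->|_] vu Pv; last by left; apply: IHu; exists (k :: v).
right; apply: IHu; exists v => //.
by rewrite mulgA -(cox_genV M i) -invgM -cox_word_cons.
Qed.

(** Cancelling equal neighbours leaves an alternating word; starting with [j] costs the first
    letter. *)
Lemma subseq_alt_word n i j v : subseq v (alt_word n i j) ->
  exists l, l <= n /\ W v = W (alt_word l i j) \/
            l < n /\ W v = W (alt_word l j i).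
Proof.
elim: n i j v => [|n IHn] i j v.
  by rewrite subseq0 => /eqP->; exists 0; left.
case: v => [_|k v /=]; first by exists 0; left.
have [-> vn|_ vn] := eqVneq k i; last first.
  have [l [[ln ->]|[/ltnW ln ->]]] := IHn _ _ _ vn; exists l; first by right.
  by left; rewrite leqW.
have [l [[ln E]|[ln E]]] := IHn _ _ _ vn.
  by exists l.+1; left; rewrite !cox_word_cons E.
case: l ln E => [|l] ln E.
  by exists 1%N; left; rewrite !cox_word_cons E.
exists l; right; split; first by rewrite ltnW // ltnW.
by rewrite cox_word_cons E cox_word_cons cox_genK.
Qed.

(** Alternating words shorter than [m] are subwords of both sides, and those of length [m] represent
    the same element. *)
Lemma subwords_braid i j m P w : i != j -> M i j = Some m ->
  subwords (alt_word m i j) P w -> subwords (alt_word m j i) P w.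
Proof.
move=> neij Mij /subwordsP[v /subseq_alt_word[l E] Pv]; apply/subwordsP.
case: E Pv => [[]|[]]; last first.
  move=> ltl -> Pv; exists (alt_word l j i) => //.
  exact/prefix_alt_word/ltnW.
rewrite leq_eqVlt; case/orP=> [/eqP-> ->|].
  by rewrite (cox_alt_braid Mij) => Pv; exists (alt_word m j i).
case: m Mij => // m Mij ltl -> Pv; exists (alt_word l i j) => //.
exact: subseq_trans (prefix_alt_word i j (ltnSE ltl)) (subseq_cons _ j).
Qed.

Lemma subwords_hecke u v : H u = H v -> subwords u = subwords v.
Proof.
move/wordP; elim=> {u v} [a b u v uv|//|u v _ uv|u v w _ uv _ vw]; first last.
- by rewrite uv vw.
- by rewrite uv.
suff uvE : subwords u = subwords v by apply/funext=> P; rewrite !subwords_cat uvE.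
apply/funext=> P; apply/funext=> w; apply/propext.
case: uv => [i|i j m neij Mij]; first by rewrite /= cox_genK; tauto.
by split; apply: subwords_braid; rewrite ?Mij // 1?eq_sym // cox_sym.
Qed.

Lemma subword_of_hecke u v a : H u = H v -> subseq a u ->
  exists2 b, subseq b v & W b = W a.
Proof.
move=> uv au; have /subwordsP[b bv E] : subwords v (eq 1) (W a).
  by rewrite -(subwords_hecke uv); apply/subwordsP; exists a; rewrite // mulVg.
by exists b => //; rewrite -[LHS]mulg1 [X in _ * X]E mulVKg.
Qed.

(** Each of two reduced words with the same Hecke class has a subword representing the element of
    the other; comparing lengths, that subword is the whole word. *)
Lemma to_hecke_inj : injective (@to_hecke I M).
Proof.
move=> w1 w2; have [u [<- sz_u]] := reduced_expr_ex w1.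
have [v [<- sz_v]] := reduced_expr_ex w2.
rewrite (to_heckeE (conj erefl sz_u)) (to_heckeE (conj erefl sz_v)) => uv.
have [x xv xE] := subword_of_hecke uv (subseq_refl u).
have [y yu yE] := subword_of_hecke (esym uv) (subseq_refl v).
have le_vu : size v <= size x.
  rewrite sz_v -yE (leq_trans (len_cox_word _ _)) //.
  by rewrite (leq_trans (size_subseq yu)) // sz_u -xE len_cox_word.
have [_] := size_subseq_leqif xv.
by rewrite eqn_leq le_vu size_subseq // => /esym/eqP <-.
Qed.

Lemma hecke_word_mem u v : H u = H v -> u =i v.
Proof.
move/wordP; elim=> {u v} [a b u v uv|//|u v _ uv|u v w _ uv _ vw] i; first last.
- by rewrite uv vw.
- by rewrite uv.
rewrite !mem_cat; congr (_ || (_ || _)); case: uv => [k|k l m neij Mij].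
  by rewrite !inE orbb.
by have m1 := cox_offdiag neij Mij; rewrite !mem_alt_word m1 (ltnW m1) orbC.
Qed.

(** The set of letters is a Hecke invariant, so any Hecke word, reduced or not, shows the
    support. *)
Lemma supp_hecke w u : to_hecke w = H u -> supp w = [set i in u].
Proof.
move=> wu; apply/setP => i; rewrite !inE; apply/asboolP/idP.
  by case=> v /to_heckeE; rewrite wu => /hecke_word_mem->.
have [v rv] := reduced_expr_ex w; exists v => //.
by rewrite -(hecke_word_mem _ (u := u)) // -wu; apply: to_heckeE.
Qed.

Definition demazure i w := if len w < len (s i * w) then s i * w else w.

(** If [s_i] does not lengthen [w], then [w] has a reduced word starting with [i], which absorbs
    another [i]. *)
Lemma hecke_gen_to_hecke i w : H [:: i] * to_hecke w = to_hecke (demazure i w).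
Proof.
rewrite /demazure; case: ifP => [lt|/negbT]; last rewrite -leqNgt => le.
  have [u [uE sz_u]] := reduced_expr_ex w.
  rewrite (to_heckeE (conj uE sz_u)) -hecke_word_cat -uE -cox_word_cons.
  by apply/esym/to_heckeE/reduced_cons; rewrite ?uE.
have [u [uE sz_u]] := reduced_expr_ex (s i * w).
have r : reduced_expr w (i :: u).
  by split; rewrite ?cox_word_cons ?uE ?cox_genK //= sz_u -len_gen_down.
rewrite (to_heckeE r) -hecke_word_cat; apply/wordP.
exact: (word_eq_rel [::] u (HeckeIdem M i)).
Qed.

Lemma hecke_word_to_hecke u w : H u * to_hecke w = to_hecke (foldr demazure w u).
Proof.
elim: u => [|i u IHu] /=; first by rewrite mul1g.
by rewrite -hecke_gen_to_hecke -IHu hecke_word_cons mulgA.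
Qed.

Lemma len_demazure i w : len w <= len (demazure i w).
Proof. by rewrite /demazure; case: ifP => // /ltnW. Qed.

Lemma demazure_eq i w : len (demazure i w) <= len w -> demazure i w = w.
Proof. by rewrite /demazure; case: ifP => // lt; rewrite leqNgt lt. Qed.

(** Lengths never decrease along the fold, so no step may lengthen. The induction uses only a length
    bound, which suffixes of [u] inherit. *)
Lemma foldr_demazure_fix u w : foldr demazure w u = w ->
  {in u, forall i, demazure i w = w}.
Proof.
move=> E; have le : len (foldr demazure w u) <= len w by rewrite E.
elim: u {E} le => //= i u IHu le.
have {IHu} fix_u := IHu (leq_trans (len_demazure i _) le).
have E : foldr demazure w u = w.
  elim: u fix_u {le} => //= k u IHu h.
  by rewrite IHu ?h ?mem_head // => l lu; rewrite h // inE lu orbT.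
rewrite E in le; move=> k; rewrite inE => /orP[/eqP->|/fix_u//].
exact: demazure_eq.
Qed.

End Matsumoto.

(** * Longest elements as Hecke idempotents *)

Section ParabolicSubgroups.
Variables (I : finType) (M : coxeter_matrix I).
Implicit Types (i j k : I) (u v a b c : seq I) (w e : coxeter_group M)
  (J K : {set I}).

Local Notation s := (cox_gen M).
Local Notation W := (cox_word M).
Local Notation H := (hecke_word M).

Lemma cox_word_rev u : (W u)^-1 = W (rev u).
Proof. by rewrite -[LHS]mul1g -(cox_word_revV M u) mulgK. Qed.

Lemma cox_subgroupP J w :
  cox_subgroup J w <-> exists2 c, {subset c <= J} & W c = w.
Proof.
split=> [|[c cJ <-] S [/= [S1 Sdiv] genS]].
  move: w; apply: smallest_sub => [|_ [j Jj <-]]; last first.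
    by exists [:: j] => // k; rewrite inE => /eqP->.
  split=> [|x y]; first by rewrite in_setE; exists [::].
  rewrite !in_setE => -[a aJ <-] [b bJ <-]; exists (a ++ rev b).
    by move=> k; rewrite mem_cat mem_rev => /orP[/aJ|/bJ].
  by rewrite cox_word_cat cox_word_rev.
elim: c cJ => [|i c IHc] cJ; first by rewrite in_setE in S1.
have Si : s i \in S.
  by rewrite in_setE; apply: genS; exists i => //=; apply/cJ/mem_head.
have /mem_set Sc : S (W c) by apply: IHc => k kc; rewrite cJ // inE kc orbT.
by apply/set_mem; rewrite cox_word_cons; apply: (group_closedM (conj S1 Sdiv)).
Qed.

Lemma sub_finite_type J K : J \subset K -> finite_type M K -> finite_type M J.
Proof.
move=> /subsetP JK; apply: sub_finite_set => w /cox_subgroupP[c cJ cw].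
by apply/cox_subgroupP; exists c => // k /cJ/JK.
Qed.

Lemma idempotent_longest e : to_hecke e * to_hecke e = to_hecke e ->
  longest M (supp e) = e.
Proof.
have [u [uE sz_u]] := reduced_expr_ex e.
have uH := to_heckeE (conj uE sz_u); rewrite {1}uH hecke_word_to_hecke.
move=> /to_hecke_inj/foldr_demazure_fix fix_u; rewrite (supp_hecke uH).
have absorb c : {subset c <= u} -> H (c ++ u) = H u.
  move=> cu; rewrite hecke_word_cat -uH hecke_word_to_hecke; congr to_hecke.
  elim: c cu => //= k c IHc cu.
  by rewrite IHc ?fix_u ?cu ?mem_head // => l lc; rewrite cu // inE lc orbT.
(* A word [c] in the letters of [u] is a prefix of [c ++ u], which has the Hecke class of [u]. *)
have sub w : cox_subgroup [set i in u] w -> exists2 b, subseq b u & W b = w.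
  move=> /cox_subgroupP[c cu <-].
  apply: (subword_of_hecke (absorb c _)); last exact: prefix_subseq.
  by move=> k /cu; rewrite inE.
have max w : cox_subgroup [set i in u] w -> len w <= len e.
  case/sub=> b bu <-; rewrite -sz_u.
  by rewrite (leq_trans (len_cox_word M b)) // size_subseq.
have mem_e : cox_subgroup [set i in u] e.
  by apply/cox_subgroupP; exists u => // k; rewrite inE.
(* A rival of maximal length comes from a subword [b] at least as long as [u], hence from [u]
   itself. *)
apply: xget_unique => [//|w [/sub[b bu <-] /(_ e mem_e) le]].
have := size_subseq_leqif bu; case=> _; rewrite eqn_leq size_subseq //=.
by rewrite sz_u (leq_trans le (len_cox_word M b)) -uE => /esym/eqP->.
Qed.

Lemma longest_ex K :
  finite_type M K -> exists w : coxeter_group M, is_longest K w.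
Proof.
move=> /finite_seqP[r rE].
pose P n := `[< exists2 w : coxeter_group M, cox_subgroup K w & len w = n >].
have exP : exists n, P n.
  exists (len (1 : coxeter_group M)); apply/asboolP; exists 1 => //.
  by apply/cox_subgroupP; exists [::].
have ubP n : P n -> n <= \max_(w <- r) len w.
  by case/asboolP => w; rewrite rE => wr <-; apply: leq_bigmax_seq.
case: (ex_maxnP exP ubP) => n /asboolP[w wK <-] maxn; exists w; split=> // v vK.
by apply: maxn; apply/asboolP; exists v.
Qed.

Lemma longest_hecke K : finite_type M K ->
  to_hecke (longest M K) * to_hecke (longest M K) = to_hecke (longest M K) /\
  supp (longest M K) = K.
Proof.
move=> /longest_ex/(xgetPex 1); rewrite -/(longest M K); set w := longest M K.
move=> [/cox_subgroupP[c cK cw] maxw].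
have fix_w i : i \in K -> demazure i w = w.
  move=> iK; rewrite /demazure ltnNge maxw //; apply/cox_subgroupP.
  exists (i :: c); last by rewrite cox_word_cons cw.
  by move=> k; rewrite inE => /orP[/eqP->|/cK].
have [u uc] := reduced_subseq_ex M c; rewrite cw => /to_heckeE uH.
have uK : {subset u <= K} by move=> k /(mem_subseq uc)/cK.
split.
  rewrite {1}uH hecke_word_to_hecke; congr to_hecke.
  elim: u uK {uc uH} => //= k u IHu uK.
  by rewrite IHu ?fix_w ?uK ?mem_head // => l lc; rewrite uK // inE lc orbT.
apply/setP => k; apply/idP/idP; first by rewrite (supp_hecke uH) inE => /uK.
(* By maximality [k] is absorbed by [w], so [k :: u] is another Hecke word of [w], and it contains
   [k]. *)
move=> kK; rewrite (supp_hecke (u := k :: u)) ?inE ?eqxx //.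
by rewrite hecke_word_cons -uH hecke_gen_to_hecke fix_w.
Qed.

Lemma supp_eq0 w : supp w = set0 <-> w = 1.
Proof.
split=> [|->]; last first.
  apply/setP=> i; rewrite !inE; apply/asboolP=> -[v [_]].
  by rewrite len1 => /size0nil->.
have [u r] := reduced_expr_ex w; rewrite (supp_hecke (to_heckeE r)).
have [<- _] := r; case: u {r} => // i u /setP/(_ i).
by rewrite !inE eqxx.
Qed.

End ParabolicSubgroups.

(** * Supports and longest elements under Hecke morphisms *)

Section HeckeMorphisms.
Variables (I' I : finType) (M' : coxeter_matrix I') (M : coxeter_matrix I).
Variable phi : coxeter_group M' -> coxeter_group M.
Hypothesis hecke_phi : hecke_morphism phi.

Lemma hecke_morphism_idem w : to_hecke w * to_hecke w = to_hecke w ->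
  to_hecke (phi w) * to_hecke (phi w) = to_hecke (phi w).
Proof.
by have [F [_ FM] FE] := hecke_phi; move=> ww; rewrite FE -FM ww.
Qed.

(** Concatenating words for the images of the letters of [w] gives a Hecke word of [phi w], from
    which [supp_hecke] reads the support. *)
Lemma supp_hecke_morphism w : supp (phi w) = bracket phi (supp w).
Proof.
have [F [F1 FM] FE] := hecke_phi; have [u /to_heckeE uH] := reduced_expr_ex w.
have [v vH vE] : exists2 v, F (hecke_word M' u) = hecke_word M v &
    forall i, (i \in v) = (i \in bracket phi [set k in u]).
  elim: u {uH} => [|k u [v vH vE]].
    exists [::]; first exact: F1.
    move=> i; apply/esym/negP => /bigcupP[k].
    by rewrite inE.
  have [x /to_heckeE xH] := reduced_expr_ex (phi (cox_gen M' k)).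
  exists (x ++ v).
    by rewrite hecke_word_cons FM vH -to_hecke_gen -FE xH hecke_word_cat.
  move=> i; rewrite mem_cat vE /bracket set_cons bigcup_setU big_set1.
  by rewrite (supp_hecke xH) !inE.
rewrite (supp_hecke uH) (supp_hecke (u := v)) -?vH -?uH -?FE //.
by apply/setP => i; rewrite inE vE.
Qed.

Lemma hecke_morphism_longest K' : finite_type M' K' ->
  phi (longest M' K') = longest M (bracket phi K').
Proof.
move=> /longest_hecke[/hecke_morphism_idem/idempotent_longest <-].
by rewrite supp_hecke_morphism => {1}->.
Qed.

End HeckeMorphisms.

Theorem theorem1p2 (I' I : finType)
    (M' : coxeter_matrix I') (M : coxeter_matrix I)
    (phi : coxeter_group M' -> coxeter_group M)
    (hecke_phi : hecke_morphism phi) (cox_phi : monoid_morphism phi) :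
  parabolic phi /\
  (injective phi <-> forall i : I', phi (cox_gen M' i) <> 1%g).
Proof.
have [phi1 phiM] := cox_phi; split=> [K' J' finK sJK|].
  exists (bracket phi J'); last first.
    rewrite /w_rel phiM !(hecke_morphism_longest hecke_phi) //.
    exact: sub_finite_type sJK finK.
  apply/subsetP=> i /bigcupP[k kJ ik]; apply/bigcupP; exists k => //.
  exact: (subsetP sJK).
split=> [inj i|gen_neq1 x y xy].
  by rewrite -phi1 => /inj/eqP; rewrite (negPf (cox_gen_neq1 M' i)).
suff: x * y^-1 = 1 by move/divg1_eq.
(* A letter [k] in the support of a kernel element would have [supp (phi s'_k)] inside this empty
   set, forcing [phi s'_k = 1]. *)
have supp_xy : bracket phi (supp (x * y^-1)) = set0.
  rewrite -(supp_hecke_morphism hecke_phi) phiM xy -phiM mulgV phi1.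
  exact/supp_eq0.
apply/supp_eq0/setP=> k; rewrite [RHS]inE; apply/negP=> k_xy.
apply: (gen_neq1 k); apply/supp_eq0/setP=> i; rewrite [RHS]inE; apply/negP=> ik.
have /setP/(_ i) := supp_xy; rewrite inE => /negP[].
by apply/bigcupP; exists k.
Qed.
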